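(* There are no $B5$-collinear integers. That is, no positive integer $k$ is $B5$-collinear.
   Context: A lattice triangle is a (non-degenerate) triangle in the plane whose three vertices lie in $\mathbb{Z}^2$. Its boundary points are the points of $\mathbb{Z}^2$ on its boundary (vertices included), and its interior points are the points of $\mathbb{Z}^2$ in its topological interior. For a positive integer $n$, a positive integer $k$ is called $Bn$-collinear if (i) there exists at least one lattice triangle with exactly $n$ boundary points and exactly $k$ interior points, and (ii) for every lattice triangle with exactly $n$ boundary points and exactly $k$ interior points, the $k$ interior points all lie on a common line. *)

(* Defs.v *)
From HB Require Import structures.
From mathcomp Require Import all_boot all_order all_algebra.
From mathcomp Require Import all_classical all_reals all_analysis.
Set Implicit Arguments.
Unset Strict Implicit.
Unset Printing Implicit Defensive.
Import Order.TTheory GRing.Theory Num.Theory.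
Import numFieldNormedType.Exports.
Local Open Scope classical_set_scope.
Local Open Scope ring_scope.
Local Open Scope card_scope.

(* The plane is R * R with its product topology; Z^2 is int * int, embedded
   in the plane by lattice_point. *)
Definition lattice_point (R : realType) (z : int * int) : R * R :=
  (z.1%:~R, z.2%:~R).

Definition collinear (R : realType) (S : set (R * R)) : Prop :=
  exists a b c : R, (a, b) != (0, 0) /\
    forall x, S x -> a * x.1 + b * x.2 = c.

(* Solid triangle: convex hull of the three vertices. *)
Definition triangle (R : realType) (p q r : R * R) : set (R * R) :=
  [set x | exists s t u : R,
     [/\ 0 <= s, 0 <= t, 0 <= u, s + t + u = 1 &
         x = (s * p.1 + t * q.1 + u * r.1, s * p.2 + t * q.2 + u * r.2)]].

Definition lattice_triangle (R : realType) (T : set (R * R)) : Prop :=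
  exists p q r : int * int,
    ~ collinear [set lattice_point R p; lattice_point R q; lattice_point R r] /\
    T = triangle (lattice_point R p) (lattice_point R q) (lattice_point R r).

Definition interior_points (R : realType) (T : set (R * R)) : set (int * int) :=
  [set z | interior T (lattice_point R z)].

Definition boundary_points (R : realType) (T : set (R * R)) : set (int * int) :=
  [set z | (closure T `\` interior T) (lattice_point R z)].

Definition triangle_with_counts (R : realType) (n k : nat) (T : set (R * R)) :
    Prop :=
  [/\ lattice_triangle T, boundary_points T #= `I_n
    & interior_points T #= `I_k].

Definition Bn_collinear (R : realType) (n k : nat) : Prop :=
  (exists T : set (R * R), triangle_with_counts n k T) /\
  (forall T : set (R * R), triangle_with_counts n k T ->
     collinear (@lattice_point R @` interior_points T)).

(* Main.v *)
(** The boundary of a lattice triangle carries as many lattice points as the sum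
    of the lattice lengths (gcds) of its sides. A common divisor of two of these
    lengths divides the third, so a sum of 5 forces the lengths 3, 1, 1. In a
    basis of Z^2 along the side of length 3 the triangle becomes (0,0), (3,0),
    (x,h) with h coprime to both x and x - 3, hence odd. For h = 1 there is no
    interior lattice point; for h >= 3 the row y = 1 contains two consecutive
    interior points and the row y = 2 contains a third one. So every lattice
    triangle with 5 boundary points and an interior point is a counterexample to
    collinearity. *)
Require Import Defs.
From mathcomp Require Import all_boot all_order all_algebra.
From mathcomp Require Import all_classical all_reals all_analysis.
From mathcomp Require Import finmap zify ring lra.
Set Implicit Arguments.
Unset Strict Implicit.
Unset Printing Implicit Defensive.
Import Order.TTheory GRing.Theory Num.Theory.
Import numFieldNormedType.Exports.
Local Open Scope classical_set_scope.
Local Open Scope ring_scope.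
Local Open Scope card_scope.

(** * Orientation, lattice lengths and primitive edge directions *)

(** Twice the signed area of the triangle [p], [q], [z]: positive when [z] lies to the left of the
    line from [p] to [q]. The ring is generic so that one formula serves both the lattice and the
    real plane. *)
Definition orient (A : pzRingType) (p q z : A * A) : A :=
  (q.1 - p.1) * (z.2 - p.2) - (q.2 - p.2) * (z.1 - p.1).

Definition lattice_length (p q : int * int) : nat :=
  gcdn `|q.1 - p.1| `|q.2 - p.2|.

(** The three edge vectors sum to zero, so each is minus the sum of the other two. *)
Lemma dvdn_lattice_length (p q r : int * int) (d : nat) :
  (d %| lattice_length p q)%N -> (d %| lattice_length q r)%N ->
  (d %| lattice_length r p)%N.
Proof.
rewrite !dvdn_gcd => /andP[a b] /andP[a' b'].
have -> : p.1 - r.1 = - ((q.1 - p.1) + (r.1 - q.1)) by ring.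
have -> : p.2 - r.2 = - ((q.2 - p.2) + (r.2 - q.2)) by ring.
rewrite !abszN.
have dvdD (x y : int) : (d %| `|x|)%N -> (d %| `|y|)%N -> (d %| `|(x + y)%R|)%N.
  by move=> dx dy; rewrite -[(_ %| _)%N]/((x + y)%R \in dvdz d) rpredD.
by apply/andP; split; apply: dvdD.
Qed.

Definition edge_direction (p q : int * int) : int * int :=
  (((q.1 - p.1) %/ lattice_length p q)%Z,
   ((q.2 - p.2) %/ lattice_length p q)%Z).

Lemma edge_directionM (p q : int * int) (v := edge_direction p q)
    (g := lattice_length p q) :
  q = (p.1 + g%:Z * v.1, p.2 + g%:Z * v.2).
Proof.
have dv (x : int) : (g %| `|x|)%N -> (x %/ g)%Z * g = x.
  by move=> gx; apply: divzK.
have g1 : (g %| `|q.1 - p.1|)%N by apply: dvdn_gcdl.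
have g2 : (g %| `|q.2 - p.2|)%N by apply: dvdn_gcdr.
rewrite [LHS]surjective_pairing ![g%:Z * _]mulrC !dv //.
by congr (_, _); ring.
Qed.

Lemma lattice_length_gt0 (p q : int * int) :
  p <> q -> (0 < lattice_length p q)%N.
Proof.
move: p q => [p1 p2] [q1 q2] /= npq; rewrite /lattice_length gcdn_gt0 /=.
rewrite !absz_gt0 !subr_eq0 -negb_and; apply/negP => /andP[/eqP e1 /eqP e2].
by apply: npq; rewrite e1 e2.
Qed.

(** Bezout coefficients of the edge vector, turned by a quarter turn, give [u]; cancelling the
    positive lattice length leaves determinant one. *)
Lemma edge_direction_unimodular (p q : int * int) (v := edge_direction p q) :
  p <> q -> exists u : int * int, v.1 * u.2 - v.2 * u.1 = 1.
Proof.
move=> /lattice_length_gt0 g0.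
have [a [b ab]] := Bezoutz (q.1 - p.1) (q.2 - p.2).
exists (- b, a) => /=.
have := edge_directionM p q; rewrite -/v => qE.
move: ab; rewrite -[gcdz _ _]/((lattice_length p q)%:Z).
rewrite [in X in X = _ -> _]qE /=.
move: g0; set g := lattice_length p q => g0 ab.
apply: (@mulfI _ g%:Z); first by lia.
by rewrite mulr1 -[RHS]ab; ring.
Qed.

(** Cramer's rule: with determinant one, the coordinates of [z] in the basis [(v, u)] based at [p]
    are integers. *)
Lemma unimodular_coords (p v u z : int * int) :
  v.1 * u.2 - v.2 * u.1 = 1 ->
  let i := (z.1 - p.1) * u.2 - (z.2 - p.2) * u.1 in
  let j := v.1 * (z.2 - p.2) - v.2 * (z.1 - p.1) in
  z = (p.1 + i * v.1 + j * u.1, p.2 + i * v.2 + j * u.2).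
Proof.
move=> vu i j; rewrite [LHS]surjective_pairing; congr (_, _).
  transitivity (p.1 + (z.1 - p.1) * (v.1 * u.2 - v.2 * u.1)).
    by rewrite vu; ring.
  by rewrite /i /j; ring.
transitivity (p.2 + (z.2 - p.2) * (v.1 * u.2 - v.2 * u.1)).
  by rewrite vu; ring.
by rewrite /i /j; ring.
Qed.

(** * Enumeration of the boundary lattice points *)

(** Half-open edge: [p] is listed and [q] is not, so that going round the triangle meets each vertex
    once. *)
Definition edge_points (p q : int * int) : seq (int * int) :=
  [seq (p.1 + i%:Z * (edge_direction p q).1,
        p.2 + i%:Z * (edge_direction p q).2) | i <- iota 0 (lattice_length p q)].

(** At the point [p + i v] of the line the two other orientations are [i * d] and [(g - i) * d] with
    [d] positive, so the weak and the strict inequality together say that [i] runs from 0 to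
    [g - 1]. *)
Lemma mem_edge_points (p q r z : int * int) : 0 < orient p q r ->
  (z \in edge_points p q) =
  [&& orient p q z == 0, 0 <= orient r p z & 0 < orient q r z].
Proof.
move=> D0.
have npq : p <> q.
  by move=> e; move: D0; rewrite e /orient !subrr !mul0r subrr ltxx.
have [u vu] := edge_direction_unimodular npq.
have g0 := lattice_length_gt0 npq.
have qE := edge_directionM p q.
rewrite /edge_points; move: vu g0 qE.
set v := edge_direction p q; set g := lattice_length p q => vu g0 qE.
set d := v.1 * (r.2 - p.2) - v.2 * (r.1 - p.1).
have De : orient p q r = g%:Z * d by rewrite /orient qE /d /=; ring.
have d0 : 0 < d by rewrite De in D0; nia.
have coordsE i : let y := (p.1 + i * v.1, p.2 + i * v.2) in
    [/\ orient p q y = 0, orient r p y = i * d & orient q r y = (g%:Z - i) * d].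
  by split; rewrite /orient ?qE /d /=; ring.
apply/mapP/and3P => [[i]|[/eqP z0 z1 z2]].
  rewrite mem_iota add0n => /andP[_ ig] ->.
  by have [-> -> ->] := coordsE i; split => //; nia.
set i := (z.1 - p.1) * u.2 - (z.2 - p.2) * u.1.
have z0' : v.1 * (z.2 - p.2) - v.2 * (z.1 - p.1) = 0.
  apply: (@mulfI _ g%:Z); first by lia.
  by rewrite mulr0 -z0 /orient qE /=; ring.
have ez : z = (p.1 + i * v.1, p.2 + i * v.2).
  by rewrite [LHS](unimodular_coords p z vu) z0' !mul0r !addr0.
move: z1 z2; rewrite ez; have [_ -> ->] := coordsE i => i0 ig.
have {}i0 : 0 <= i by nia.
have {}ig : i < g%:Z by nia.
exists `|i|%N; first by rewrite mem_iota; lia.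
by rewrite gez0_abs.
Qed.

Lemma edge_points_uniq (p q : int * int) : p <> q -> uniq (edge_points p q).
Proof.
move=> npq; have [u vu] := edge_direction_unimodular npq.
rewrite map_inj_uniq ?iota_uniq // => i j [].
set v := edge_direction p q in vu *.
move=> /addrI e1 /addrI e2.
suff : i%:Z = j by lia.
rewrite -[LHS]mulr1 -[RHS]mulr1 -vu !mulrBr !mulrA.
by rewrite -/v e1 e2.
Qed.

Definition boundary_seq (p q r : int * int) :=
  edge_points p q ++ edge_points q r ++ edge_points r p.

Lemma size_boundary_seq (p q r : int * int) :
  size (boundary_seq p q r) =
  (lattice_length p q + lattice_length q r + lattice_length r p)%N.
Proof. by rewrite !size_cat !size_map !size_iota addnA. Qed.

Lemma orient_cycle (A : comPzRingType) (p q r : A * A) :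
  orient q r p = orient p q r.
Proof. by rewrite /orient; ring. Qed.

Lemma orient_sum (A : comPzRingType) (p q r z : A * A) :
  orient p q z + orient q r z + orient r p z = orient p q r.
Proof. by rewrite /orient; ring. Qed.

Lemma orient_neq (p q r : int * int) : 0 < orient p q r -> p <> q.
Proof. by move=> + e; rewrite e /orient !subrr !mul0r subrr ltxx. Qed.

(** The sign patterns that characterise the three half-open edges exclude one another. *)
Lemma boundary_seq_uniq (p q r : int * int) :
  0 < orient p q r -> uniq (boundary_seq p q r).
Proof.
move=> D; have D' := D; rewrite -orient_cycle in D'.
have D'' := D'; rewrite -orient_cycle in D''.
rewrite !cat_uniq !edge_points_uniq; try exact: orient_neq; last 3 first.
- exact: (orient_neq D'').
- exact: (orient_neq D').
- exact: (orient_neq D).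
rewrite andbT /=; apply/andP; split; apply/hasPn => z.
  rewrite mem_cat (mem_edge_points _ D) (mem_edge_points _ D').
  by rewrite (mem_edge_points _ D''); lia.
by rewrite (mem_edge_points _ D') (mem_edge_points _ D''); lia.
Qed.

Definition strictly_inside (p q r z : int * int) :=
  [&& 0 < orient p q z, 0 < orient q r z & 0 < orient r p z].

Definition weakly_inside (p q r z : int * int) :=
  [&& 0 <= orient p q z, 0 <= orient q r z & 0 <= orient r p z].

(** The three orientations sum to a positive number, so they never vanish together; when one or two
    vanish, the sign pattern selects exactly one half-open edge. *)
Lemma mem_boundary_seq (p q r z : int * int) : 0 < orient p q r ->
  (z \in boundary_seq p q r) =
  weakly_inside p q r z && ~~ strictly_inside p q r z.
Proof.
move=> D; have D' := D; rewrite -orient_cycle in D'.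
have D'' := D'; rewrite -orient_cycle in D''.
rewrite !mem_cat (mem_edge_points _ D) (mem_edge_points _ D').
rewrite (mem_edge_points _ D'') /weakly_inside /strictly_inside.
have := orient_sum p q r z; move: D.
move: (orient p q z) (orient q r z) (orient r p z) (orient p q r) => a b c d.
by move=> d0 s; apply/idP/idP; lia.
Qed.

(** * Three non-collinear interior points in the lattice *)

(* In the basis (v, u), with v the primitive direction of the side of lattice
   length 3, the triangle is (0,0), (3,0), (x,h). *)
Lemma noncollinear_inside_lengths311 (p q r z0 : int * int) :
  0 < orient p q r -> strictly_inside p q r z0 ->
  lattice_length p q = 3%N -> lattice_length q r = 1%N ->
  lattice_length r p = 1%N ->
  exists z1 z2 z3 : int * int,
    [/\ strictly_inside p q r z1, strictly_inside p q r z2,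
        strictly_inside p q r z3 & orient z1 z2 z3 != 0].
Proof.
move=> D z0in g1 g2 g3.
have D' := D; rewrite -orient_cycle in D'.
have D'' := D'; rewrite -orient_cycle in D''.
have [u vu] := edge_direction_unimodular (orient_neq D).
have [u2] := edge_direction_unimodular (orient_neq D').
have [u3] := edge_direction_unimodular (orient_neq D'').
have := edge_directionM p q; have := edge_directionM q r.
have := edge_directionM r p; rewrite g1 g2 g3.
move: vu; set v := edge_direction p q.
set v2 := edge_direction q r; set v3 := edge_direction r p.
move=> vu e3 e2 e1 vu3 vu2.
set h : int := v.1 * (r.2 - p.2) - v.2 * (r.1 - p.1).
set x : int := (r.1 - p.1) * u.2 - (r.2 - p.2) * u.1.
have De : orient p q r = 3 * h by rewrite /orient e1 /h /=; ring.
have h0 : 0 < h by lia.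
have rE : r = (p.1 + x * v.1 + h * u.1, p.2 + x * v.2 + h * u.2).
  exact: unimodular_coords.
have coordsE i j : let y := (p.1 + i * v.1 + j * u.1, p.2 + i * v.2 + j * u.2) in
    [/\ orient p q y = 3 * j, orient r p y = h * i - x * j
      & orient q r y = 3 * h - 3 * j - (h * i - x * j)].
  have e (y : int * int) : orient q r y =
      orient p q r - orient p q y - orient r p y.
    by rewrite -(orient_sum p q r y); ring.
  move=> y.
  have E1 : orient p q y = 3 * j.
    transitivity (3 * j * (v.1 * u.2 - v.2 * u.1)); last by rewrite vu mulr1.
    by rewrite /orient e1 /y /=; ring.
  have E2 : orient r p y = h * i - x * j.
    transitivity ((h * i - x * j) * (v.1 * u.2 - v.2 * u.1)).
      by rewrite /orient rE /y /=; move: h x {E1 De h0 rE y} => h x; ring.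
    by rewrite vu mulr1.
  by rewrite e E1 E2 De.
have insideE i j :
    strictly_inside p q r (p.1 + i * v.1 + j * u.1, p.2 + i * v.2 + j * u.2) =
    [&& 0 < 3 * j, 0 < 3 * h - 3 * j - (h * i - x * j) & 0 < h * i - x * j].
  by rewrite /strictly_inside; have [-> -> ->] := coordsE i j.
(* The side from [r] to [p] has length 1, so its vector, with coordinates [(-x, -h)], is primitive:
   [x] and [h] are coprime. *)
have [a [b ab]] : exists a b : int, x * a + h * b = 1.
  exists (- (v.1 * u3.2 - v.2 * u3.1)), (- (u.1 * u3.2 - u.2 * u3.1)).
  have v31 : v3.1 = - (x * v.1 + h * u.1).
    have := congr1 fst e3; rewrite rE /=; lia.
  have v32 : v3.2 = - (x * v.2 + h * u.2).
    have := congr1 snd e3; rewrite rE /=; lia.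
  by rewrite -[RHS]vu3 v31 v32; ring.
(* The same for the side from [q] to [r], whose coordinates are [(x - 3, h)]. *)
have [c [d cd]] : exists c d : int, (x - 3) * c + h * d = 1.
  exists (v.1 * u2.2 - v.2 * u2.1), (u.1 * u2.2 - u.2 * u2.1).
  have v21 : v2.1 = (x - 3) * v.1 + h * u.1.
    have := congr1 fst e2; rewrite rE e1 /=; lia.
  have v22 : v2.2 = (x - 3) * v.2 + h * u.2.
    have := congr1 snd e2; rewrite rE e1 /=; lia.
  by rewrite -[RHS]vu2 v21 v22; ring.
clearbody h x.
(* One of [x] and [x - 3] is even, so it would share the factor 2 with [h]. *)
have hn2 : h <> 2.
  move=> h2; move: ab cd; rewrite h2 => ab cd.
  have := divz_eq x 2; have := modz_ge0 x (isT : 2 != 0 :> int).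
  have := ltz_pmod x (isT : 0 < 2 :> int).
  move: (x %% 2)%Z (x %/ 2)%Z => f e f2 f0 xe.
  have : f = 0 \/ f = 1 by lia.
  by case=> f_; rewrite f_ in xe; rewrite xe in ab cd; nia.
(* An interior point lies in a row strictly between 0 and [h], and [z0] is one. *)
have hn1 : h <> 1.
  move=> h1; move: z0in; rewrite (unimodular_coords p z0 vu) insideE h1.
  move: (v.1 * _ - _) => j; move: (x * j) => xj; lia.
have h3 : 3 <= h by lia.
have hnz : h != 0 by lia.
(* As [x] is invertible modulo [h], [h] dividing [x] would make [h] divide 1; likewise [h] dividing
   [2 * x] would make it divide 2. *)
have fx : (x %% h)%Z != 0.
  apply/eqP => f0; have := divz_eq x h; rewrite f0 addr0 => xe.
  have : h * ((x %/ h)%Z * a + b) = 1 by rewrite -ab [in RHS]xe; ring.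
  by move: (_ + b) => t; clear -h3;
    have [t0|t0] : t <= 0 \/ 1 <= t; lia || nia.
have fx2 : ((2 * x) %% h)%Z != 0.
  apply/eqP => f0; have := divz_eq (2 * x) h; rewrite f0 addr0 => xe.
  have : h * (((2 * x) %/ h)%Z * a + 2 * b) = 2.
    transitivity ((2 * x) * a + 2 * h * b); first by rewrite [in RHS]xe; ring.
    by rewrite -[RHS]mulr1 -ab; ring.
  by move: (_ + 2 * b) => t; clear -h3;
    have [t0|t0] : t <= 0 \/ 1 <= t; lia || nia.
have := divz_eq x h; have := divz_eq (2 * x) h.
have := modz_ge0 x hnz; have := modz_ge0 (2 * x) hnz.
have := ltz_pmod x h0; have := ltz_pmod (2 * x) h0.
move: fx fx2; move: (x %% h)%Z (x %/ h)%Z => f e.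
move: ((2 * x) %% h)%Z ((2 * x) %/ h)%Z => f' e' fn0 f'n0 f'h fh f'0 f0 xe' xe.
(* The side from [p] to [r] crosses row 1 at [x / h] and row 2 at [2 x / h]; [e] and [e'] are the
   floors, so the witnesses are the first two integers beyond it in row 1 and the first one in row
   2. Nonzero remainders [f], [f'] keep them strictly inside the opposite side even when [h] is
   3. *)
exists (p.1 + (e + 1) * v.1 + 1 * u.1, p.2 + (e + 1) * v.2 + 1 * u.2).
exists (p.1 + (e + 2) * v.1 + 1 * u.1, p.2 + (e + 2) * v.2 + 1 * u.2).
exists (p.1 + (e' + 1) * v.1 + 2 * u.1, p.2 + (e' + 1) * v.2 + 2 * u.2).
split.
- rewrite insideE !mulr1 xe.
  by rewrite (_ : h * (e + 1) - _ = h - f); [lia|ring].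
- rewrite insideE !mulr1 xe.
  by rewrite (_ : h * (e + 2) - _ = 2 * h - f); [lia|ring].
- rewrite insideE [x * 2]mulrC xe'.
  by rewrite (_ : h * (e' + 1) - _ = h - f'); [lia|ring].
(* The differences from the first point are [v] and an integer multiple of [v] plus [u], so their
   determinant is that of the basis. *)
- rewrite (_ : orient _ _ _ = 1) // -[RHS]vu /orient /=; ring.
Qed.

Lemma strictly_inside_cycle (p q r z : int * int) :
  strictly_inside q r p z = strictly_inside p q r z.
Proof. by rewrite /strictly_inside; lia. Qed.

Lemma noncollinear_inside (p q r z0 : int * int) :
  0 < orient p q r -> strictly_inside p q r z0 ->
  size (boundary_seq p q r) = 5%N ->
  exists z1 z2 z3 : int * int,
    [/\ strictly_inside p q r z1, strictly_inside p q r z2,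
        strictly_inside p q r z3 & orient z1 z2 z3 != 0].
Proof.
rewrite size_boundary_seq => D z0in.
have D' := D; rewrite -orient_cycle in D'.
have D'' := D'; rewrite -orient_cycle in D''.
(* Positive lengths with sum 5 are 3, 1, 1 or 2, 2, 1 in some order; divisibility by 2 rules out the
   latter. *)
have P1 := @dvdn_lattice_length p q r 2.
have P2 := @dvdn_lattice_length q r p 2.
have P3 := @dvdn_lattice_length r p q 2.
have := lattice_length_gt0 (orient_neq D).
have := lattice_length_gt0 (orient_neq D').
have := lattice_length_gt0 (orient_neq D'') => g3 g2 g1 g.
have : [\/ [/\ lattice_length p q = 3%N, lattice_length q r = 1%N
             & lattice_length r p = 1%N],
           [/\ lattice_length q r = 3%N, lattice_length r p = 1%N
             & lattice_length p q = 1%N]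
         | [/\ lattice_length r p = 3%N, lattice_length p q = 1%N
             & lattice_length q r = 1%N]].
  move: g1 g2 g3 g P1 P2 P3.
  move: (lattice_length p q) (lattice_length q r) (lattice_length r p).
  move=> [|[|[|[|a]]]] [|[|[|[|b]]]] [|[|[|[|c]]]] // _ _ _ s P1 P2 P3;
    do ?[lia | by constructor 1 | by constructor 2 | by constructor 3
        | by move: (P1 isT isT) | by move: (P2 isT isT)
        | by move: (P3 isT isT)].
case=> -[].
- exact: noncollinear_inside_lengths311 D z0in.
- move: z0in; rewrite -strictly_inside_cycle => z0in l1 l2 l3.
  have [z1 [z2 [z3]]] := noncollinear_inside_lengths311 D' z0in l1 l2 l3.
  by rewrite !(strictly_inside_cycle p q r) => zs; exists z1, z2, z3.
- move: z0in; rewrite -(strictly_inside_cycle p) -(strictly_inside_cycle q).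
  move=> z0in l1 l2 l3.
  have [z1 [z2 [z3]]] := noncollinear_inside_lengths311 D'' z0in l1 l2 l3.
  rewrite !(strictly_inside_cycle q r p) !(strictly_inside_cycle p q r) => zs.
  by exists z1, z2, z3.
Qed.

(** * Interior and closure of a real triangle *)

Lemma triangle_swap (R : realType) (p q r : R * R) :
  triangle q p r = triangle p q r.
Proof.
apply/seteqP; split => x [s [t [u [s0 t0 u0 stu ->]]]]; exists t, s, u;
  by split => //; [rewrite -stu; ring | congr (_, _); ring].
Qed.

(** The barycentric coordinates of [x] are its three orientations divided by that of the
    triangle. *)
Lemma triangleE (R : realType) (p q r : R * R) : 0 < orient p q r ->
  triangle p q r =
  [set x | [/\ 0 <= orient p q x, 0 <= orient q r x & 0 <= orient r p x]].
Proof.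
move=> D0; apply/seteqP; split => x /=.
  case=> s [t [u [s0 t0 u0 stu ->]]].
  have -> : s = 1 - t - u by rewrite -stu; ring.
  set y := (_, _).
  have E1 : orient p q y = u * orient p q r by rewrite /orient /y /=; ring.
  have E2 : orient q r y = (1 - t - u) * orient p q r.
    by rewrite /orient /y /=; ring.
  have E3 : orient r p y = t * orient p q r by rewrite /orient /y /=; ring.
  have s0' : 0 <= 1 - t - u by lra.
  by rewrite E1 E2 E3 !mulr_ge0 // ltW.
case=> a0 b0 c0; have nD : orient p q r != 0 by rewrite gt_eqF.
exists (orient q r x / orient p q r), (orient r p x / orient p q r),
  (orient p q x / orient p q r).
split; rewrite ?divr_ge0 ?(ltW D0) //.
  by rewrite -!mulrDl -(orient_sum p q r x) addrC addrA divff // orient_sum.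
rewrite [LHS]surjective_pairing.
have e1 : x.1 * orient p q r =
    orient q r x * p.1 + orient r p x * q.1 + orient p q x * r.1.
  by rewrite /orient; ring.
have e2 : x.2 * orient p q r =
    orient q r x * p.2 + orient r p x * q.2 + orient p q x * r.2.
  by rewrite /orient; ring.
congr (_, _).
  apply: (mulIf nD); rewrite e1.
  by move: (orient p q r) nD (orient q r x) (orient r p x) => d nd b c; field.
apply: (mulIf nD); rewrite e2.
by move: (orient p q r) nD (orient q r x) (orient r p x) => d nd b c; field.
Qed.

Lemma orient_continuous (R : realType) (p q : R * R) :
  continuous (orient p q).
Proof.
move=> x; apply: cvgB; apply: cvgM; try exact: cvg_cst; apply: cvgB;
  by [exact: cvg_fst|exact: cvg_snd|exact: cvg_cst].
Qed.

(** A small move from [x] along the normal of the line [p q], towards its right side, stays in [T]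
    and strictly lowers the orientation, which is still nonnegative afterwards. *)
Lemma interior_orient_gt0 (R : realType) (T : set (R * R)) (p q x : R * R) :
  p <> q -> (forall y, T y -> 0 <= orient p q y) -> interior T x ->
  0 < orient p q x.
Proof.
move=> npq Tpos Tx.
pose n := (q.1 - p.1) ^+ 2 + (q.2 - p.2) ^+ 2.
have n0 : 0 < n.
  rewrite lt_neqAle addr_ge0 ?sqr_ge0 // andbT eq_sym paddr_eq0 ?sqr_ge0 //.
  rewrite !sqrf_eq0 !subr_eq0; apply/negP => /andP[/eqP e1 /eqP e2].
  by apply: npq; rewrite [p]surjective_pairing -e1 -e2 -surjective_pairing.
(* The direction is the edge vector turned by a quarter turn, so the orientation grows at rate [n],
   the squared edge length. *)
pose line (t : R) := (x.1 - t * (q.2 - p.2), x.2 + t * (q.1 - p.1)).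
have lineE t : orient p q (line t) = orient p q x + t * n.
  by rewrite /orient /line /n /=; ring.
have : line t @[t --> (0 : R)] --> line 0.
  apply: (@cvg_pair _ _ _ _ (nbhs (line 0).1) (nbhs (line 0).2)) => /=;
    [apply: cvgB|apply: cvgD];
    by [exact: cvg_cst|apply: cvgM; [exact: cvg_id|exact: cvg_cst]].
have line0 : line 0 = x.
  by rewrite /line !mul0r subr0 addr0 -surjective_pairing.
rewrite line0 => /(_ _ Tx) /= /nbhs_ballP[e /= e0 eT].
have : T (line (- (e / 2))).
  by apply: eT; rewrite /ball /= sub0r opprK gtr0_norm; lra.
move=> /Tpos; rewrite lineE.
by have : 0 < e / 2 * n by [rewrite mulr_gt0 //; lra]; lra.
Qed.

(** The half-plane lemma applied to each side gives one inclusion; for the other, the strict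
    inequalities cut out an open subset of the triangle. *)
Lemma interior_triangle (R : realType) (p q r : R * R) : 0 < orient p q r ->
  interior (triangle p q r) =
  [set x | [/\ 0 < orient p q x, 0 < orient q r x & 0 < orient r p x]].
Proof.
move=> D0; rewrite triangleE //; apply/seteqP; split => [x Tx|].
  have npp (a b : R * R) : orient a a b = 0.
    by rewrite /orient !subrr !mul0r subrr.
  split; apply: (interior_orient_gt0 _ _ Tx); try by move=> y [].
  - by move=> e; move: D0; rewrite e npp ltxx.
  - by move=> e; move: D0; rewrite -orient_cycle e npp ltxx.
  - by move=> e; move: D0; rewrite -2!orient_cycle e npp ltxx.
rewrite -open_subsetE => [x [a b c]|]; first by split; apply: ltW.
rewrite [X in open X](_ : _ = orient p q @^-1` [set y | 0 < y]
  `&` (orient q r @^-1` [set y | 0 < y] `&` orient r p @^-1` [set y | 0 < y])).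
  apply: openI; [|apply: openI];
    by apply: open_comp; [move=> ? _; exact: orient_continuous|exact: open_gt].
by apply/seteqP; split => x [a b]; [split|case: b; split].
Qed.

Lemma closure_triangle (R : realType) (p q r : R * R) : 0 < orient p q r ->
  closure (triangle p q r) = triangle p q r.
Proof.
move=> D0; apply/esym/closure_id; rewrite triangleE //.
rewrite [X in closed X](_ : _ = orient p q @^-1` [set y | 0 <= y]
  `&` (orient q r @^-1` [set y | 0 <= y] `&` orient r p @^-1` [set y | 0 <= y])).
  apply: closedI; [|apply: closedI]; apply: closed_comp;
    by [move=> ? _; exact: orient_continuous|exact: closed_ge].
by apply/seteqP; split => x [a b]; [split|case: b; split].
Qed.

(** * Transfer between the real plane and the lattice *)

Lemma orient_lattice_point (R : realType) (p q z : int * int) :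
  orient (lattice_point R p) (lattice_point R q) (lattice_point R z) =
  (orient p q z)%:~R.
Proof. by rewrite /orient /lattice_point /= !rmorphB /= !rmorphM !rmorphB. Qed.

Lemma interior_points_triangle (R : realType) (p q r z : int * int) :
  0 < orient p q r ->
  interior_points
    (triangle (lattice_point R p) (lattice_point R q) (lattice_point R r)) z
  <-> strictly_inside p q r z.
Proof.
move=> D0; rewrite /interior_points /= interior_triangle; last first.
  by rewrite orient_lattice_point ltr0z.
rewrite /= !orient_lattice_point !ltr0z.
exact: (rwP and3P).
Qed.

Lemma boundary_points_triangle (R : realType) (p q r : int * int) :
  0 < orient p q r ->
  boundary_points
    (triangle (lattice_point R p) (lattice_point R q) (lattice_point R r))
  = [set` boundary_seq p q r].
Proof.
move=> D0; have D0R : 0 < orient (lattice_point R p) (lattice_point R q)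
    (lattice_point R r) by rewrite orient_lattice_point ltr0z.
apply/seteqP; split => z; rewrite /boundary_points /= closure_triangle //;
  rewrite mem_boundary_seq //;
  have := interior_points_triangle R z D0; rewrite /interior_points /= => zP;
  rewrite [X in X (lattice_point R z)]triangleE //= !orient_lattice_point !ler0z.
  case=> /and3P zT zI; apply/andP; split=> //.
  by apply/negP => /zP.
by case/andP => /and3P zT /negP zI; split=> // /zP.
Qed.

(** Both [a] and [b] times the orientation are combinations of differences of the line equation at
    the three points, hence zero, and one of the two coefficients is nonzero. *)
Lemma collinear_orient_eq0 (R : realType) (S : set (R * R)) (x y z : R * R) :
  collinear S -> S x -> S y -> S z -> orient x y z = 0.
Proof.
case=> a [b [c [ab0 Sl]]] /Sl x0 /Sl y0 /Sl z0.
have ea : a * orient x y z = 0.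
  transitivity ((a * y.1 + b * y.2 - (a * x.1 + b * x.2)) * (z.2 - x.2)
     - (a * z.1 + b * z.2 - (a * x.1 + b * x.2)) * (y.2 - x.2)).
    by rewrite /orient; ring.
  by rewrite x0 y0 z0; ring.
have eb : b * orient x y z = 0.
  transitivity ((a * z.1 + b * z.2 - (a * x.1 + b * x.2)) * (y.1 - x.1)
     - (a * y.1 + b * y.2 - (a * x.1 + b * x.2)) * (z.1 - x.1)).
    by rewrite /orient; ring.
  by rewrite x0 y0 z0; ring.
apply/eqP; apply: contraTT ab0 => o0; rewrite negbK.
move/eqP: ea; rewrite mulf_eq0 (negbTE o0) orbF => /eqP->.
by move/eqP: eb; rewrite mulf_eq0 (negbTE o0) orbF => /eqP->.
Qed.

Lemma orient0_collinear (R : realType) (x y z : R * R) :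
  orient x y z = 0 -> collinear [set x; y; z].
Proof.
case: (eqVneq x y) => [<- _|nxy o0].
  case: (eqVneq x z) => [<-|nxz].
    (* All three points coincide: the vertical line through [x] serves. *)
    exists 1, 0, x.1; split; first by rewrite xpair_eqE oner_eq0.
    by move=> w /= [[|]|] ->; rewrite mul1r mul0r addr0.
  exists (- (z.2 - x.2)), (z.1 - x.1),
    (- (z.2 - x.2) * x.1 + (z.1 - x.1) * x.2); split.
    apply: contraNneq nxz => -[/eqP + /eqP].
    rewrite oppr_eq0 !subr_eq0 => /eqP e2 /eqP e1.
    by rewrite [x]surjective_pairing -e1 -e2 -surjective_pairing.
  by move=> w /= [[|]|] ->; ring.
exists (- (y.2 - x.2)), (y.1 - x.1),
  (- (y.2 - x.2) * x.1 + (y.1 - x.1) * x.2); split.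
  apply: contraNneq nxy => -[/eqP + /eqP].
  rewrite oppr_eq0 !subr_eq0 => /eqP e2 /eqP e1.
  by rewrite [x]surjective_pairing -e1 -e2 -surjective_pairing.
move=> w /= [[|]|] ->; try ring.
by apply/eqP; rewrite -subr_eq0 -o0 /orient; apply/eqP; ring.
Qed.

(** Swapping two vertices flips the sign of the orientation, and non-collinearity excludes zero. *)
Lemma lattice_triangle_oriented (R : realType) (T : set (R * R)) :
  lattice_triangle T -> exists p q r : int * int, 0 < orient p q r /\
    T = triangle (lattice_point R p) (lattice_point R q) (lattice_point R r).
Proof.
case=> p [q [r [ncol ->]]]; case: (ltrgtP (orient p q r) 0) => o.
- exists q, p, r; rewrite triangle_swap; split => //.
  rewrite (_ : orient q p r = - orient p q r) ?oppr_gt0 //.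
  by rewrite /orient; ring.
- by exists p, q, r.
- case: ncol; apply: orient0_collinear.
  by rewrite orient_lattice_point o.
Qed.

(** * Counting and conclusion *)

Lemma size_uniq_card (T : choiceType) (s : seq T) (n : nat) :
  uniq s -> [set` s] #= `I_n -> size s = n.
Proof.
move=> us.
have -> : [set` s] = [set` seq_fset tt s].
  by apply: eq_set => z; rewrite seq_fsetE.
by move/card_eq_fsetP; rewrite size_seq_fset undup_id.
Qed.

Theorem theorem2 (R : realType) (k : nat) (hk : (0 < k)%N) :
  ~ Bn_collinear R 5 k.
Proof.
(* The triangle that clause (i) provides is itself the one that violates clause (ii). *)
case=> -[T Tk] /(_ T Tk) Tcol; case: Tk Tcol => /lattice_triangle_oriented.
move=> [p [q [r [D0 ->]]]]; rewrite boundary_points_triangle // => bd int col.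
have [z0 z0in] : exists z0, strictly_inside p q r z0.
  case: k hk int => // k _ /eq_cardSP[z zin _].
  by exists z; apply/(interior_points_triangle R z D0).
have bd5 : size (boundary_seq p q r) = 5%N.
  by apply: size_uniq_card bd; apply: boundary_seq_uniq.
have [z1 [z2 [z3 [i1 i2 i3]]]] := noncollinear_inside D0 z0in bd5.
(* A nonzero integer orientation stays nonzero in [R]. *)
rewrite -(intr_eq0 R) -orient_lattice_point => /eqP; apply.
by apply: (collinear_orient_eq0 col);
  [exists z1|exists z2|exists z3] => //; apply/interior_points_triangle.
Qed.
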